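(* Let $v>9$ be an integer with $v\equiv 1 \pmod 4$. If there exists an $\mathrm{STS}(v)$ admitting a zero-sum $k$-flow for some integer $k\ge 2$, then there exists an $\mathrm{STS}(2v+7)$ admitting a zero-sum $k$-flow.
   Context: A Steiner triple system $\mathrm{STS}(v)$ is a pair $(X,\mathcal{B})$ where $|X|=v$ and $\mathcal{B}$ is a collection of 3-subsets (blocks) of $X$ such that every 2-subset of $X$ lies in exactly one block. For a design $(X,\mathcal{B})$ and an integer $n\ge 2$, a zero-sum $n$-flow is a map $f:\mathcal{B}\to\{\pm1,\pm2,\ldots,\pm(n-1)\}$ such that for every point $x\in X$, $\sum_{B\in\mathcal{B},\,x\in B} f(B)=0$. *)

(* Defs.v *)
From mathcomp Require Import all_boot all_order all_algebra.
Set Implicit Arguments. Unset Strict Implicit. Unset Printing Implicit Defensive.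
Import GRing.Theory Num.Theory.

Definition is_STS (v : nat) (B : {set {set 'I_v}}) : Prop :=
  (forall b, b \in B -> #|b| = 3) /\
  (forall x y : 'I_v, x != y ->
     #|[set b in B | (x \in b) && (y \in b)]| = 1).

Definition zero_sum_flow (v : nat) (B : {set {set 'I_v}}) (n : nat)
    (f : {set 'I_v} -> int) : Prop :=
  (forall b, b \in B -> (0 < `|f b| < n)%N) /\
  (forall x : 'I_v, (\sum_(b in B | x \in b) f b)%R = 0%R).

Definition has_zero_sum_flow (v : nat) (B : {set {set 'I_v}}) (n : nat) : Prop :=
  exists f, zero_sum_flow B n f.

(* Main.v *)
(**
An STS with a signed weight on each block is the same as a Steiner quasigroup
[t] (idempotent, commutative, [t x (t x y) = y]) with a weight [w x y]
depending only on the block of [x] and [y]; the flow condition becomes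
[\sum_(y != x) w x y = 0], since each block through [x] is counted twice.

Write [v + 7 = 4m].  To the given system we add the points [(i, p, x)], with a
side [i] in [{A, B}], a parity [p] and a residue [x] modulo [m].  Each new point
lies in three triangles, each with two vertices on one side and one on the
other; the remaining [v]-regular graph on the new points is split into [v]
perfect matchings, and every old point is joined to the edges of its own
matching.  Signs on the new blocks:
- a triangle is +1 when its majority side is [A] and -1 otherwise, so that the
  triangles contribute +1 at points of [A] and -1 at points of [B];
- a matching inside the sides is [s] on [A] and [-s] on [B], with signs [s]
  summing to -1 over the [2m - 3] such matchings;
- a matching between the sides, [(A, p, x) -- (B, p + r, x + c)], carries
  [s * (-1)^p]; for each [r] the signs [s] of the remaining shifts [(r, c)] must
  sum to 0, hence their number must be even.  This parity requirement is why the
  triangles on the majority side [B] depend on whether [m] is odd.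
*)
Require Import Defs.
From mathcomp Require Import all_boot all_order all_algebra.
From mathcomp Require Import zify ring.
Set Implicit Arguments. Unset Strict Implicit. Unset Printing Implicit Defensive.
Import GRing.Theory Num.Theory.
Local Open Scope ring_scope.

(** * Weighted Steiner quasigroups *)

Record steiner_flow (T : finType) (k : nat) (t : T -> T -> T) (w : T -> T -> int)
  : Prop := SteinerFlow {
  third_id : idempotent_op t;
  thirdC : commutative t;
  thirdK : forall x, involutive (t x);
  flowC : commutative w;
  flow_third : forall x y, w x (t x y) = w x y;
  flow_range : forall x y, x != y -> (0 < `|w x y| < k)%N;
  flow_sum : forall x, \sum_(y | y != x) w x y = 0 }.

(** Renaming of points: it serves to name the old points by matchings, and at the end to return to
    an ordinal. *)
Lemma steiner_flow_transport (T U : finType) k t w :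
  #|T| = #|U| -> @steiner_flow T k t w -> exists t' w', @steiner_flow U k t' w'.
Proof.
move=> cTU H.
pose h (x : T) : U := enum_val (cast_ord cTU (enum_rank x)).
pose h' (y : U) : T := enum_val (cast_ord (esym cTU) (enum_rank y)).
have hK : cancel h h' by move=> x; rewrite /h /h' enum_valK cast_ordK enum_rankK.
have h'K : cancel h' h by move=> x; rewrite /h /h' enum_valK cast_ordKV enum_rankK.
exists (fun x y => h (t (h' x) (h' y))), (fun x y => w (h' x) (h' y)).
split=> [x|x y|x y|x y|x y|x y ne|x].
- by rewrite /= (third_id H).
- by rewrite (thirdC H).
- by rewrite hK (thirdK H).
- exact: flowC H _ _.
- by rewrite hK (flow_third H).
- by apply: (flow_range H); rewrite (can_eq h'K).
- apply: etrans (flow_sum H (h' x)); rewrite (reindex h) /=; last first.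
    by exists h' => y _; rewrite ?hK ?h'K.
  apply: eq_big => [y|y _]; last by rewrite hK.
  by rewrite -{1}(h'K x) (can_eq hK).
Qed.

(** * Passage between block systems and quasigroups *)

Section Blocks.
Variables (v : nat) (B : {set {set 'I_v}}).
Hypothesis BP : is_STS B.

Lemma block_unique (b c : {set 'I_v}) x y : x != y ->
  b \in B -> c \in B -> x \in b -> y \in b -> x \in c -> y \in c -> b = c.
Proof.
move=> ne bB cB xb yb xc yc; have /eqP/cards1P[d dP] := BP.2 _ _ ne.
have: b \in [set d] by rewrite -dP inE bB xb yb.
have: c \in [set d] by rewrite -dP inE cB xc yc.
by rewrite !inE => /eqP-> /eqP->.
Qed.

(** A block through [x] has two further points, so grouping the [y] by their block meets each block
    twice. *)
Lemma sum_block_pairs (blk : 'I_v -> 'I_v -> {set 'I_v}) (f : {set 'I_v} -> int) x :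
  (forall y, y != x -> [/\ blk x y \in B, x \in blk x y & y \in blk x y]) ->
  \sum_(y | y != x) f (blk x y) = (\sum_(b in B | x \in b) f b) *+ 2.
Proof.
move=> blkP; rewrite (partition_big (blk x) (fun b => (b \in B) && (x \in b))) /=;
  last by move=> y /blkP[-> ->].
rewrite -sumrMnl; apply: eq_bigr => b /andP[bB xb].
rewrite (eq_bigr (fun=> f b)) => [|y /andP[_ /eqP->] //].
rewrite (eq_bigl (mem (b :\ x))) => [|y].
  rewrite sumr_const; congr (_ *+ _).
  by have := cardsD1 x b; rewrite (BP.1 _ bB) xb => -[].
rewrite !inE /=; case: eqVneq => //= ne; have [cB xc yc] := blkP _ ne.
apply/eqP/idP => [<- //|yb].
by apply: (@block_unique _ _ x y) => //; rewrite eq_sym.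
Qed.

Lemma steiner_flow_of_STS k :
  has_zero_sum_flow B k -> exists t w, @steiner_flow 'I_v k t w.
Proof.
move=> [f [fr fs]].
(* Off the diagonal this block exists and is unique; the value at [x = y] is arbitrary and
   harmless. *)
pose blk (x y : 'I_v) := odflt set0 [pick b in B | (x \in b) && (y \in b)].
have blkP x y : x != y -> [/\ blk x y \in B, x \in blk x y & y \in blk x y].
  move=> ne; rewrite /blk; case: pickP => [b /and3P[]//|none].
  have := BP.2 _ _ ne; rewrite (_ : [set b in B | _] = set0) ?cards0 //.
  by apply/setP => b; rewrite !inE; apply: none.
have blkE x y b : x != y -> b \in B -> x \in b -> y \in b -> blk x y = b.
  by move=> ne bB xb yb; have [? ? ?] := blkP _ _ ne; apply: (@block_unique _ _ x y).
have blkC x y : blk x y = blk y x.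
  by have [->//|ne] := eqVneq x y; have [? ? ?] := blkP _ _ ne;
     rewrite (@blkE y x (blk x y)) // eq_sym.
pose t x y := if x == y then x else odflt x [pick z in blk x y | (z != x) && (z != y)].
have tP x y : x != y -> [/\ t x y \in blk x y, t x y != x & t x y != y].
  move=> ne; rewrite /t (negPf ne); case: pickP => [z /and3P[]//|none].
  have [bB xb yb] := blkP _ _ ne.
  have := cardsD1 x (blk x y); rewrite (cardsD1 y (_ :\ _)) (BP.1 _ bB) xb !inE yb eq_sym ne.
  rewrite (_ : _ :\ _ :\ _ = set0) ?cards0 //.
  by apply/setP => z; rewrite !inE -(none z) andbA [RHS]andbC; congr andb; rewrite andbC.
have tE x y z : x != y -> z \in blk x y -> z != x -> z != y -> t x y = z.
  move=> ne zb zx zy; have [tb tx ty] := tP _ _ ne.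
  have [bB xb yb] := blkP _ _ ne.
  (* Otherwise the block would contain four distinct points [x], [y], [z], [t x y]. *)
  apply/eqP; apply: contraT => tz; have := BP.1 _ bB.
  rewrite (cardsD1 x) (cardsD1 y) (cardsD1 z) (cardsD1 (t x y)) !inE.
  by rewrite xb yb zb tb zx zy tx ty tz (eq_sym y) ne.
have tC : commutative t.
  move=> x y; have [->//|ne] := eqVneq x y; have [tb tx ty] := tP _ _ ne.
  by rewrite [RHS](tE _ _ (t x y)) // 1?blkC // eq_sym.
have blkt x y : x != y -> blk x (t x y) = blk x y.
  move=> ne; have [tb tx ty] := tP _ _ ne; have [? ? ?] := blkP _ _ ne.
  by apply: blkE; rewrite // eq_sym.
have tid : idempotent_op t by move=> x; rewrite /t eqxx.
exists t, (fun x y => f (blk x y)); split=> //.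
- move=> x y; have [->|ne] := eqVneq x y; first by rewrite !tid.
  have [tb tx ty] := tP _ _ ne; have [? ? ?] := blkP _ _ ne.
  by apply: tE; rewrite 1?blkt // eq_sym.
- by move=> x y; rewrite blkC.
- move=> x y; have [->|ne] := eqVneq x y; first by rewrite tid.
  by rewrite blkt.
- by move=> x y ne; have [? ? ?] := blkP _ _ ne; apply: fr.
- move=> x; rewrite (@sum_block_pairs blk) ?fs ?mul0rn // => y ne.
  by apply: blkP; rewrite eq_sym.
Qed.
End Blocks.

Lemma STS_of_steiner_flow v k t w : @steiner_flow 'I_v k t w ->
  exists B : {set {set 'I_v}}, is_STS B /\ has_zero_sum_flow B k.
Proof.
move=> H; have tC := thirdC H.
have tx x y : x != y -> t x y != x.
  by apply: contra => /eqP e; rewrite -(thirdK H x y) e (third_id H).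
have ty x y : x != y -> t x y != y by rewrite tC eq_sym; apply: tx.
pose blk x y : {set 'I_v} := [set x; y; t x y].
have blkC x y : blk y x = blk x y by rewrite /blk tC (setUC [set y]).
have blkt x y : blk x (t x y) = blk x y by rewrite /blk (thirdK H) setUAC.
have wC := flowC H; have wt := flow_third H.
(* Any two distinct points of a block regenerate it with the same weight. This gives uniqueness of
   blocks and makes [f] below independent of the pair picked. *)
have same x y p q : p != q -> p \in blk x y -> q \in blk x y ->
    blk p q = blk x y /\ w p q = w x y.
  rewrite !inE -!orbA => ne /or3P[] /eqP Ep /or3P[] /eqP Eq;
    move: ne; rewrite {p}Ep {q}Eq ?eqxx // => _.
  - by rewrite (tC x) blkt wt blkC wC.
  - by rewrite (blkC x) (wC _ x) blkt wt.
  - by rewrite (blkC y) (wC _ y) (tC x) blkt wt blkC wC.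
pose B := [set b | [exists u : 'I_v * 'I_v, (u.1 != u.2) && (b == blk u.1 u.2)]].
have BE b : reflect (exists x y, x != y /\ b = blk x y) (b \in B).
  rewrite inE; apply: (iffP existsP) => [[[x y] /andP[ne /eqP->]]|[x [y [ne ->]]]].
    by exists x, y.
  by exists (x, y); rewrite ne eqxx.
have in_blk x y : (x \in blk x y) * (y \in blk x y).
  by split; rewrite !inE eqxx ?orbT.
have BP : is_STS B.
  split=> [b /BE[x [y [ne ->]]]|x y ne].
    by rewrite /blk setUC cardsU1 cards2 ne !inE negb_or tx ?ty.
  apply/eqP/cards1P; exists (blk x y); apply/setP => b; rewrite inE [RHS]inE.
  apply/idP/eqP => [/andP[/BE[p [q [_ ->]]] /andP[xb yb]]|->].
    by have [] := same _ _ _ _ ne xb yb.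
  by rewrite !(in_blk x y) !andbT; apply/BE; exists x, y.
pose f (b : {set 'I_v}) :=
  if [pick u | (u.1 != u.2) && (b == blk u.1 u.2)] is Some u then w u.1 u.2 else 0.
have fE x y : x != y -> f (blk x y) = w x y.
  move=> ne; rewrite /f; case: pickP => [[p q] /andP[/= npq /eqP e]|/(_ (x, y))/=].
    by have [] := @same x y p q; rewrite ?e ?(in_blk p q).
  by rewrite ne eqxx.
exists B; split=> //; exists f; split=> [b /BE[x [y [ne ->]]]|x].
  by rewrite fE //; apply: flow_range H _ _ ne.
have := @sum_block_pairs _ _ BP blk f x.
rewrite (eq_bigr (w x)) => [|y ne]; last by rewrite fE // eq_sym.
rewrite (flow_sum H) => /(_ _)/esym/eqP; rewrite mulrn_eq0 => e.
apply/eqP/e => y ne; split; rewrite ?(in_blk x y) //.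
by apply/BE; exists x, y; rewrite eq_sym.
Qed.

Lemma has_STS_flow_iff v k :
  (exists B : {set {set 'I_v}}, is_STS B /\ has_zero_sum_flow B k) <->
  exists t w, @steiner_flow 'I_v k t w.
Proof.
split=> [[B [BP Bf]]|[t [w]]]; first exact: (steiner_flow_of_STS BP Bf).
exact: STS_of_steiner_flow.
Qed.

(** * Adjoining points by matchings and triangles *)

(* [lab u u'] is the matching containing the edge [u u'], [pi c u] the partner of
   [u] in the matching [c], and [z u u'] completes [u u'] to a triangle when
   [lab u u' = None]; [s] and [g] are the signs. *)
Lemma steiner_flow_extend (C W : finType) k (t : C -> C -> C) (w : C -> C -> int)
    (lab : W -> W -> option C) (pi : C -> W -> W) (z : W -> W -> W)
    (s : C -> W -> int) (g : W -> W -> int) :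
  (1 < k)%N -> steiner_flow k t w ->
  (forall u u', lab u u' = lab u' u) ->
  (forall c u, lab u (pi c u) = Some c) ->
  (forall u u' c, lab u u' = Some c -> pi c u = u') ->
  (forall u, lab u u = None) -> (forall u, z u u = u) ->
  (forall u u', lab u u' = None ->
     [/\ z u' u = z u u', lab u (z u u') = None & z u (z u u') = u']) ->
  (forall c u, s c (pi c u) = s c u) ->
  (forall u u', lab u u' = None -> g u' u = g u u' /\ g u (z u u') = g u u') ->
  (forall c u, `|s c u|%N = 1%N) -> (forall u u', `|g u u'|%N = 1%N) ->
  (forall c, \sum_u s c u = 0) ->
  (forall u, (\sum_c s c u) *+ 2 + \sum_(u' | (u' != u) && (lab u u' == None)) g u u' = 0) ->
  exists t' w', @steiner_flow (C + W)%type k t' w'.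
Proof.
move=> k1 H labC labpi pilab labid zid zP spi gP s1 g1 ssum gsum.
have piK c : involutive (pi c).
  by move=> u; apply: pilab; rewrite labC labpi.
have pi_neq c u : pi c u != u.
  by apply/eqP => e; have := labpi c u; rewrite e labid.
exists (fun a b => match a, b with
  | inl c, inl d => inl (t c d)
  | inl c, inr u | inr u, inl c => inr (pi c u)
  | inr u, inr u' => if lab u u' is Some c then inl c else inr (z u u') end).
exists (fun a b => match a, b with
  | inl c, inl d => w c d
  | inl c, inr u | inr u, inl c => s c u
  | inr u, inr u' => if lab u u' is Some c then s c u else g u u' end).
split.
- by case=> [c|u] /=; rewrite ?(third_id H) ?labid ?zid.
- case=> [c|u] [d|u'] //=; first by rewrite (thirdC H).
  rewrite (labC u'); case E: (lab u u') => [//|].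
  by have [->] := zP _ _ E.
- case=> [c|u] [d|u'] /=; rewrite ?(thirdK H) ?piK ?labpi //.
  case E: (lab u u') => [c|]; first by rewrite (pilab _ _ _ E).
  by have [_ -> ->] := zP _ _ E.
- case=> [c|u] [d|u'] //=; first by rewrite (flowC H).
  rewrite (labC u'); case E: (lab u u') => [c|]; last by have [->] := gP _ _ E.
  by rewrite -(pilab _ _ _ E) spi.
- case=> [c|u] [d|u'] /=; rewrite ?(flow_third H) ?spi ?labpi //.
  case E: (lab u u') => [c|] //=.
  by have [_ ->] := zP _ _ E; have [_ ->] := gP _ _ E.
- case=> [c|u] [d|u'] ne /=; rewrite ?s1 //; first exact: (flow_range H).
  by case: (lab u u') => [c|]; rewrite ?s1 ?g1.
- case=> [c|u]; rewrite big_sumType /=.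
    by rewrite (flow_sum H) add0r; apply: ssum.
  (* At a new point [u] the sign [s c u] occurs twice, at the old point [c] and at the partner
     [pi c u], which share a block with [u]. *)
  rewrite (bigID (fun u' => lab u u' == None)) /= -[RHS](gsum u) mulr2n -addrA.
  congr +%R; rewrite addrC; congr +%R; last first.
    by apply: eq_big => // u' /andP[_ /eqP->].
  transitivity (\sum_(u' | lab u u' != None) \sum_(c | lab u u' == Some c) s c u).
    apply: eq_big => [u'|u' /andP[_]].
      have [->|ne] := eqVneq u' u; first by rewrite labid !eqxx.
      by rewrite (_ : inr u' != inr u).
    by case E: (lab u u') => [c|] // _; rewrite (eq_bigl (pred1 c)) ?big_pred1_eq.
  rewrite (exchange_big_dep predT) //=; apply: eq_bigr => c _.
  rewrite (big_pred1 (pi c u)) // => u'; apply/andP/eqP => [[_ /eqP/pilab]|->] //.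
  by rewrite labpi eqxx.
Qed.

(** * Balanced signs and swaps along pairs *)

Lemma card_notin (T : finType) (A : {pred T}) (s : seq T) :
  uniq s -> (forall x, (x \in A) = (x \notin s)) -> (#|A| + size s = #|T|)%N.
Proof.
move=> /card_uniqP <- AE; rewrite -(cardC A); congr addn.
by apply: eq_card => x; rewrite !inE AE negbK.
Qed.

(** Signs alternating along an enumeration cancel in consecutive pairs, leaving 1 exactly when the
    length is odd. *)
Lemma balanced_signs (I : finType) (A : {pred I}) : exists sg : I -> int,
  (forall i, `|sg i|%N = 1%N) /\ \sum_(i in A) sg i = odd #|A|.
Proof.
exists (fun i => (-1) ^+ index i (enum A)); split=> [i|]; first by rewrite abszX exp1n.
rewrite -big_enum cardE /=; have := enum_uniq A; elim/last_ind: (enum A) => [|e i IH].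
  by rewrite big_nil.
rewrite rcons_uniq => /andP[ie ue]; rewrite big_rcons /= size_rcons -cats1.
rewrite index_cat (negPf ie) /= eqxx addn0 -signr_odd.
rewrite (eq_big_seq (fun j => (-1) ^+ index j e)) => [|j je]; last by rewrite index_cat je.
by rewrite IH //; case: odd.
Qed.

Definition swap_pairs (T : eqType) (s : seq (T * T)) (x0 x : T) : T :=
  foldr (fun ab r => if x == ab.1 then ab.2 else if x == ab.2 then ab.1 else r) x0 s.

Lemma swap_pairs_default (T : eqType) (s : seq (T * T)) x0 x :
  x \notin unzip1 s ++ unzip2 s -> swap_pairs s x0 x = x0.
Proof.
elim: s => [//|[a b] s IH]; rewrite /= inE mem_cat inE !negb_or.
by case/and4P=> /negPf-> ? /negPf-> ?; apply: IH; rewrite mem_cat negb_or; apply/andP.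
Qed.

Lemma swap_pairsP (T : eqType) (s : seq (T * T)) x0 a b :
  uniq (unzip1 s ++ unzip2 s) -> (a, b) \in s ->
  swap_pairs s x0 a = b /\ swap_pairs s x0 b = a.
Proof.
elim: s => [//|[c e] s IH].
have -> : uniq (unzip1 ((c, e) :: s) ++ unzip2 ((c, e) :: s)) =
    uniq [:: c, e & unzip1 s ++ unzip2 s].
  by apply: perm_uniq; rewrite /= perm_cons (perm_catCA _ [:: e]).
rewrite /= inE negb_or; case/and3P=> /andP[ce cs] es /IH {}IH; rewrite inE.
rewrite xpair_eqE; case/orP => [/andP[/eqP-> /eqP->]|abs].
  by rewrite !eqxx; case: eqVneq.
have am : a \in unzip1 s ++ unzip2 s by rewrite mem_cat (map_f fst abs).
have bm : b \in unzip1 s ++ unzip2 s by rewrite mem_cat (map_f snd abs) orbT.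
have neq x y : x \in unzip1 s ++ unzip2 s -> y \notin unzip1 s ++ unzip2 s -> (x == y) = false.
  by move=> xs; apply: contraNF => /eqP <-.
by rewrite !neq //; apply: IH.
Qed.

Lemma sum_eqE (T U : eqType) :
  ((forall a b : T, ((inl a : T + U) == inl b) = (a == b)) *
   (forall a b : U, ((inr a : T + U) == inr b) = (a == b)) *
   (forall (a : T) (b : U), ((inl a : T + U) == inr b) = false) *
   (forall (a : T) (b : U), ((inr b : T + U) == inl a) = false))%type.
Proof. by []. Qed.

(** * Matchings and triangles on the new points *)

Section SignedFactorization.
Variable M : finComNzRingType.
Hypothesis two_neq0 : 2 != 0 :> M.

(* Points [(side, parity, residue)], with [false] standing for the side A;
   [K] indexes the matchings, see [good]. *)
Local Notation W := (bool * bool * M)%type.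
Local Notation K := (M + M + bool * M)%type.
Local Notation Sum c := (inl (inl c)).
Local Notation Shift c := (inl (inr c)).
Local Notation Cross c := (inr c).

(* Throughout, [d] is meant to be [odd #|M|]. *)
Definition near d i (e : M) := (e == 0) || [&& i, d & (e == 1) || (e == -1)].

(* The matching containing the edge [uv], or a label that is not [good] when
   [u = v] or [uv] lies in a triangle. *)
Definition label d (u v : W) : K :=
  let: (i, p, x) := u in let: (j, q, y) := v in
  if i == j then
    if p == q then if near d i (y - x) then Shift 0 else Sum (x + y)
    else if near d i (y - x) then Sum (x + y) else Shift (if p then x - y else y - x)
  else Cross (p (+) q, if i then x - y else y - x).

(** The reflection [x -> a - x] may have fixed points; there the parity flips instead. For odd [m]
    it also flips between neighbouring residues on side B, whose edges of equal parity belong to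
    triangles. *)
Definition partner d (c : K) (u : W) : W :=
  let: (i, p, x) := u in
  match c with
  | Sum a => (i, p (+) near d i (a - x - x), a - x)
  | Shift a => (i, ~~ p, if p then x - a else x + a)
  | Cross (r, a) => (~~ i, p (+) r, if i then x - a else x + a)
  end.

(** [Shift 0] is free to mark non-edges, because opposite parities at equal residues are joined by a
    [Sum] matching. The excluded [Cross] labels are the cross edges of triangles: [(false, 0)] and
    [(true, 1)] for majority A, the other two for majority B. *)
Definition good d (c : K) :=
  match c with
  | Sum _ => true
  | Shift a => a \notin [:: 0; 1; -1]
  | Cross ra => ra \notin [:: (false, 0); (false, 1); (true, 1); (~~ d, 2)]
  end.

(* The pairs [(v, w)] such that [u], [v], [w] form a triangle. *)
Definition triangles d (u : W) : seq (W * W) :=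
  let: (i, p, x) := u in
  if i then
    [:: ((false, p, x), (false, ~~ p, x - 1));
        ((false, p, x - 1), (true, p (+) ~~ d, x + 1));
        ((false, p (+) ~~ d, x - 2), (true, p (+) ~~ d, x - 1))]
  else
    [:: ((false, ~~ p, x - 1), (true, p, x));
        ((false, ~~ p, x + 1), (true, ~~ p, x + 1));
        ((true, p, x + 1), (true, p (+) ~~ d, x + 2))].

Definition mates d u : seq W := unzip1 (triangles d u) ++ unzip2 (triangles d u).

(** The default [u] yields [third d u u = u], as [u] is not among its own mates. *)
Definition third d (u v : W) : W := swap_pairs (triangles d u) u v.

Lemma eq_sub_false (e a b : M) : e != 0 -> a - b = e -> (a == b) = false.
Proof. by move=> e0 E; rewrite -subr_eq0 E (negPf e0). Qed.

Let one_neq0 : 1 != 0 :> M := oner_neq0 M.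
Let none_neq0 : -1 != 0 :> M. Proof. by rewrite oppr_eq0. Qed.
Let ntwo_neq0 : -2 != 0 :> M. Proof. by rewrite oppr_eq0. Qed.

(* Decides [x + a == x + b] when [a - b] is among 0, 1, -1, 2, -2. *)
Ltac eval_eq := repeat match goal with
  | |- context [@eq_op ?T ?a ?b] =>
    unify (Equality.sort T) (GRing.ComNzRing.sort M) ;
    first
    [ rewrite (_ : @eq_op T a b = true); [|apply/eqP; ring]
    | rewrite (_ : @eq_op T a b = false);
      [|first [ apply: (@eq_sub_false 1); [exact: one_neq0|ring]
              | apply: (@eq_sub_false (-1)); [exact: none_neq0|ring]
              | apply: (@eq_sub_false 2); [exact: two_neq0|ring]
              | apply: (@eq_sub_false (-2)); [exact: ntwo_neq0|ring]]]]; rewrite /=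
  end.

Lemma uniq_mates d u : uniq (u :: mates d u).
Proof.
case: u => [[i p] x]; rewrite /mates; case: i p d => [] [] []; rewrite /= !inE ?xpair_eqE /=.
all: by eval_eq.
Qed.

Lemma third_self d u : third d u u = u.
Proof. by apply: swap_pairs_default; have /andP[] := uniq_mates d u. Qed.

Lemma third_triangle d u v w :
  (v, w) \in triangles d u -> third d u v = w /\ third d u w = v.
Proof. by apply: swap_pairsP; have /andP[] := uniq_mates d u. Qed.

(** Each triangle is listed at all three of its vertices, possibly with the pair reversed; hence
    [third] is symmetric on triangles. *)
Lemma triangles_sym d u : all (fun vw =>
    (((u, vw.2) \in triangles d vw.1) || ((vw.2, u) \in triangles d vw.1)) &&
    (((u, vw.1) \in triangles d vw.2) || ((vw.1, u) \in triangles d vw.2)))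
  (triangles d u).
Proof.
case: u => [[i p] x]; case: i p d => [] [] []; rewrite /= !inE !xpair_eqE /=.
all: by eval_eq.
Qed.

Lemma thirdP d u v : v \in mates d u ->
  [/\ third d v u = third d u v, third d u v \in mates d u & third d u (third d u v) = v].
Proof.
rewrite mem_cat => /orP[] /mapP[[a b] T /= ->] {v}; have [E1 E2] := third_triangle T;
  rewrite ?E1 ?E2 ?E1;
  have /andP[/= Ta Tb] := allP (triangles_sym d u) _ T.
  split=> //; last by rewrite mem_cat (map_f snd T) orbT.
  by case/orP: Ta => /third_triangle[].
split=> //; last by rewrite mem_cat (map_f fst T).
by case/orP: Tb => /third_triangle[].
Qed.

Lemma good_label d (u v : W) : good d (label d u v) = (v \notin u :: mates d u).
Proof.
case: u v => [[i p] x] [[j q] y].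
(* Both sides depend on the residues only through the difference [e]; the values 0, 1, -1, which
   [near] singles out, are treated separately. *)
have [e ->] : exists e, y = x + e by exists (y - x); ring.
have E1 : x + e - x = e by ring.
have E2 : x - (x + e) = - e by ring.
have E3 c : (x + e == x + c) = (e == c) by rewrite (inj_eq (addrI x)).
have E4 : (x + e == x) = (e == 0) by rewrite -{2}[x]addr0 E3.
have E5 c : (- e == c) = (e == - c) by rewrite eqr_oppLR.
rewrite /mates; case: i p j q d => [] [] [] [] [].
all: rewrite /label /near /= ?inE ?xpair_eqE /= ?E1 ?E2 ?E3 ?E4.
all: have [->|/negPf n0] := eqVneq e 0;
  [ rewrite ?oppr0 /= ?inE; eval_eq
  | rewrite ?n0; case E6: (e == 1); case E7: (e == -1);
    rewrite /= ?inE ?xpair_eqE /= ?E5 ?opprK ?oppr0 ?n0 ?E6 ?E7 ?orbF].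
all: try by [].
all: by rewrite ?eqxx ?orbT.
Qed.

Lemma label_sym d (u v : W) : label d u v = label d v u.
Proof.
case: u v => [[i p] x] [[j q] y]; rewrite /label (eq_sym j) (eq_sym q) (addbC q).
have nearN k (e : M) : near d k (- e) = near d k e.
  by rewrite /near !eqr_oppLR oppr0 opprK [_ || (e == 1)]orbC.
rewrite -(nearN _ (x - y)) opprB; have [<-|] := eqVneq i j; last by case: i j => [] [].
by rewrite (addrC y x); case: p q => [] []; case: near => //=.
Qed.

Lemma label_partner d c (u : W) : good d c -> label d u (partner d c u) = c.
Proof.
case: u => [[i p] x].
have addKl (a : M) : x + a - x = a by ring.
have subKl (a : M) : x - a - x = - a by ring.
have subKr (a : M) : x - (x - a) = a by ring.
have addsubK (a : M) : x + (a - x) = a by ring.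
case: c => [[a|a]|[r a]] gc /=.
- by rewrite eqxx addsubK; case: (near _ _ _); case: p.
- move: gc; rewrite eqxx /= !inE !negb_or => /and3P[/negPf a0 /negPf a1 /negPf a2].
  have far : near d i a = false by rewrite /near a0 a1 a2 !andbF.
  have farN : near d i (- a) = false.
    by rewrite /near !eqr_oppLR oppr0 opprK a0 a1 a2 !andbF.
  by case: p; rewrite /= ?subKl ?addKl ?far ?farN ?subKr.
- rewrite (_ : (i == ~~ i) = false); last by case: i.
  by rewrite addKb; case: i; rewrite ?subKr ?addKl.
Qed.

Lemma partner_label d (u v : W) : good d (label d u v) -> partner d (label d u v) u = v.
Proof.
case: u v => [[i p] x] [[j q] y]; rewrite /=.
have E : x + y - x - x = y - x by ring.
have E' : x + y - x = y by ring.
have subKr : x - (x - y) = y by ring.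
have addsubK : x + (y - x) = y by ring.
have [<-|ne] := eqVneq i j; last first.
  have -> : j = ~~ i by case: i j ne => [] [].
  move=> _ /=; rewrite addKb.
  by case: i {ne}; rewrite ?subKr ?addsubK.
have [<-|ne] := eqVneq p q.
  by case N: near => /=; [rewrite !inE eqxx | rewrite E E' N addbF].
have -> : q = ~~ p by case: p q ne => [] [].
case N: near => /= _; first by rewrite E E' N addbT.
by case: p {ne}; rewrite ?subKr ?addsubK.
Qed.

(** * Numbers of matchings and their parities *)

Lemma card_good d : (#|[pred c : K | good d c]| + 7 = 4 * #|M|)%N.
Proof.
pose s : seq K := [:: Shift 0; Shift 1; Shift (-1); Cross (false, 0);
  Cross (false, 1); Cross (true, 1); Cross (~~ d, 2)].
rewrite (@card_notin _ _ s) => [| |[[a|a]|[r a]]].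
- by rewrite !card_sum card_prod card_bool !mulSn !addn0 !addnA.
- by rewrite /s; case: d {s}; rewrite /= !inE !(sum_eqE, xpair_eqE) /=; eval_eq.
- by [].
- by rewrite /s /= !inE /= ?inE ?sum_eqE ?orbF.
- by rewrite /s /= !inE /= ?inE ?sum_eqE ?orbF.
Qed.

Lemma card_good_inl d : (#|[pred c : M + M | good d (inl c)]| + 3 = 2 * #|M|)%N.
Proof.
rewrite (@card_notin _ _ [:: inr 0; inr 1; inr (-1)]) => [||[a|a]].
- by rewrite !card_sum mul2n addnn.
- by rewrite /= ?inE ?sum_eqE /=; eval_eq.
- by [].
- by rewrite /= !inE /= ?inE ?sum_eqE ?orbF.
Qed.

(** For odd [m] the classes [r] lose 3 and 1 residues, for even [m] 2 each; placing the residue 2 in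
    class [~~ d] achieves this. *)
Lemma odd_card_good_Cross d r : odd #|M| = d ->
  odd #|[pred a : M | good d (Cross (r, a))]| = false.
Proof.
move=> oM.
have [s us sP] : exists2 s : seq M, uniq s /\ odd (size s) = d &
    forall a, good d (Cross (r, a)) = (a \notin s).
  case: d r {oM} => [] [].
  - by exists [:: 1] => // a; rewrite /= !inE !xpair_eqE /= ?orbF.
  - exists [:: 0; 1; 2]; first by rewrite /= ?inE; eval_eq.
    by move=> a; rewrite /= !inE !xpair_eqE /= ?orbF.
  - exists [:: 1; 2]; first by rewrite /= ?inE; eval_eq.
    by move=> a; rewrite /= !inE !xpair_eqE /= ?orbF.
  - exists [:: 0; 1]; first by rewrite /= ?inE; eval_eq.
    by move=> a; rewrite /= !inE !xpair_eqE /= ?orbF.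
have := congr1 odd (@card_notin _ [pred a : M | good d (Cross (r, a))] s us.1 sP).
by rewrite oddD us.2 oM; case: odd; case: d {oM us sP}.
Qed.

(** * Signs of the new blocks *)

Lemma balanced_labels d : odd #|M| = d -> exists sg : K -> int,
  [/\ forall c, `|sg c|%N = 1%N, \sum_(c | good d (inl c)) sg (inl c) = -1
    & forall r, \sum_(a | good d (Cross (r, a))) sg (Cross (r, a)) = 0].
Proof.
move=> oM.
have [f [f1 fs]] := balanced_signs [pred c : M + M | good d (inl c)].
have [g0 [g01 g0s]] := balanced_signs [pred a : M | good d (Cross (false, a))].
have [g1 [g11 g1s]] := balanced_signs [pred a : M | good d (Cross (true, a))].
exists (fun c => match c with
  | inl c => - f c | Cross (r, a) => if r then g1 a else g0 a end); split.
- by case=> [c|[[] a]] //; rewrite abszN.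
(* The number [2m - 3] of these labels is odd, so [f] sums to 1. *)
- rewrite sumrN fs; congr (- _).
  by have := congr1 odd (card_good_inl d); rewrite oddD oddM /=; case: odd.
- by case; rewrite ?g1s ?g0s odd_card_good_Cross.
Qed.

(** For a [Cross] label the exponent is the parity of the endpoint on side A, so that both ends of
    an edge read the same sign. *)
Definition sign (sg : K -> int) (c : K) (u : W) : int :=
  let: (i, p, x) := u in
  if c is Cross (r, _) then (-1) ^+ (p (+) (i && r)) * sg c else (-1) ^+ i * sg c.

(* The sign of the majority side. *)
Definition triangle_sign d (u v : W) : int :=
  let: (i, j, k) := (u.1.1, v.1.1, (third d u v).1.1) in
  (-1) ^+ [|| i && j, i && k | j && k].

Lemma sign_partner d sg c u : sign sg c (partner d c u) = sign sg c u.
Proof.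
case: u => [[i p] x]; case: c => [[a|a]|[r a]] //=.
by congr (_ * _); case: i p r => [] [] [].
Qed.

Lemma abs_sign sg c u : (forall c, `|sg c|%N = 1%N) -> `|sign sg c u|%N = 1%N.
Proof.
move=> sg1; case: u => [[i p] x]; case: c => [[a|a]|[r a]] /=;
by rewrite abszM sg1 abszX exp1n.
Qed.

Lemma sum_sign sg c : \sum_u sign sg c u = 0.
Proof.
(* A sign-reversing involution: it exchanges parities for a cross matching and sides for any
   other. *)
pose flip (u : W) : W := let: (i, p, x) := u in
  if c is Cross _ then (i, ~~ p, x) else (~~ i, p, x).
have flipK : involutive flip.
  by case=> [[i p] x]; rewrite /flip; case: c {flip} => [?|?]; rewrite negbK.
have flipN u : sign sg c (flip u) = - sign sg c u.
  case: u => [[i p] x]; rewrite /flip /sign.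
  by case: c {flip flipK} => [[a|a]|[r a]]; case: i; case: p; try case: r; rewrite /=; ring.
have : \sum_u sign sg c u = - \sum_u sign sg c u.
  rewrite {1}(reindex_inj (inv_inj flipK)) -sumrN.
  by apply: eq_bigr => u _; apply: flipN.
by lia.
Qed.

Lemma sum_good_sign d sg u :
  \sum_(c | good d (inl c)) sg (inl c) = -1 ->
  (forall r, \sum_(a | good d (Cross (r, a))) sg (Cross (r, a)) = 0) ->
  \sum_(c : K | good d c) sign sg c u = - (-1) ^+ u.1.1.
Proof.
case: u => [[i p] x] si sc; rewrite big_sumType /=.
rewrite (eq_bigr (fun c => (-1) ^+ i * sg (inl c))) => [|[a|a] _] //.
rewrite -mulr_sumr si mulrN1 -[RHS]addr0; congr +%R.
transitivity (\sum_r \sum_(a | good d (Cross (r, a))) sign sg (Cross (r, a)) (i, p, x)).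
  by rewrite pair_big_dep; apply: eq_big => [[r a]|[r a] _].
by rewrite big1 // => r _; rewrite -mulr_sumr sc mulr0.
Qed.

Lemma triangle_signC d u v :
  v \in mates d u -> triangle_sign d v u = triangle_sign d u v.
Proof.
move=> uv; have [E _ _] := thirdP uv; rewrite /triangle_sign E.
by case: (u.1.1) (v.1.1) (third d u v).1.1 => [] [] [].
Qed.

Lemma triangle_sign_third d u v :
  v \in mates d u -> triangle_sign d u (third d u v) = triangle_sign d u v.
Proof.
move=> uv; have [_ _ E] := thirdP uv; rewrite /triangle_sign E.
by case: (u.1.1) (v.1.1) (third d u v).1.1 => [] [] [].
Qed.

(** Of the three triangles at [u], two have the side of [u] as majority and one has the other; each
    counts for two mates. *)
Lemma sum_triangle_sign d u :
  \sum_(v <- mates d u) triangle_sign d u v = (-1) ^+ u.1.1 *+ 2.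
Proof.
have T : all (fun vw => (third d u vw.1 == vw.2) && (third d u vw.2 == vw.1)) (triangles d u).
  by apply/allP => -[v w] /third_triangle[] -> ->; rewrite !eqxx.
move: T; rewrite /triangle_sign /mates; case: u => [[i p] x].
case: i => /=; case/and4P => /andP[/eqP E1 /eqP E2] /andP[/eqP E3 /eqP E4] /andP[/eqP E5 /eqP E6] _;
by rewrite !big_cons big_nil E1 E2 E3 E4 E5 E6.
Qed.

(** * Assembly of the extended system *)

Lemma steiner_flow_adjoin (T : finType) k (t : T -> T -> T) (w : T -> T -> int) :
  (1 < k)%N -> (#|T| + 7 = 4 * #|M|)%N -> steiner_flow k t w ->
  exists t' w', @steiner_flow (T + W)%type k t' w'.
Proof.
move=> k1 cT H; pose d := odd #|M|.
have [sg [sg1 sgi sgc]] := balanced_labels (erefl d).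
(* The old points are identified with the good labels: both number [4m - 7]. *)
pose C := {c : K | c \in [pred c | good d c]}.
have cTC : #|T| = #|{: C}|.
  have := card_good d; rewrite -cT => /addIn <-.
  by rewrite card_sig; apply: eq_card.
have [t1 [w1 H1]] := steiner_flow_transport cTC H.
pose lab u v : option C := insub (label d u v).
have labN u v : (lab u v == None) = (v \in u :: mates d u).
  rewrite -[RHS]negbK -good_label /lab.
  by case: insubP => [c g _|/negPf g]; rewrite inE in g; rewrite g.
have labN' u v : lab u v = None -> u = v \/ v \in mates d u.
  by move/eqP; rewrite labN inE => /predU1P[]; [left|right].
have [t2 [w2 H2]] : exists t' w', @steiner_flow (C + W)%type k t' w'.
  apply: (@steiner_flow_extend C W k t1 w1 lab (fun c => partner d (val c)) (third d)
    (fun c => sign sg (val c)) (triangle_sign d)) => //.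
  - by move=> u v; rewrite /lab label_sym.
  - by move=> c u; rewrite /lab label_partner ?valK //; apply: (valP c).
  - move=> u v c; rewrite /lab; case: insubP => // c' g E [<-]; rewrite E.
    exact: partner_label.
  - by move=> u; apply/eqP; rewrite labN mem_head.
  - exact: third_self.
  - move=> u v /labN'[<-|vu].
      by rewrite !third_self; split=> //; apply/eqP; rewrite labN mem_head.
    have [E1 E2 E3] := thirdP vu; split=> //.
    by apply/eqP; rewrite labN inE E2 orbT.
  - by move=> c u; apply: sign_partner.
  - move=> u v /labN'[<-|vu]; first by rewrite third_self.
    by rewrite triangle_signC // triangle_sign_third.
  - by move=> c u; apply: abs_sign.
  - by move=> u v; rewrite /triangle_sign abszX exp1n.
  - by move=> c; apply: sum_sign.
  (* The matchings contribute [-2] times [(-1) ^+ u.1.1], cancelling the triangles. *)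
  - move=> u; rewrite -(big_sub _ (fun c => sign sg c u)).
    rewrite (sum_good_sign u sgi sgc) (eq_bigl (mem (mates d u))).
      by rewrite -big_uniq ?sum_triangle_sign ?mulNrn ?addNr //; have /andP[] := uniq_mates d u.
    move=> v; rewrite labN inE /=; case: eqVneq => [->|//].
    by have /andP[/negPf->] := uniq_mates d u.
by apply: steiner_flow_transport H2; rewrite !card_sum cTC.
Qed.
End SignedFactorization.

Theorem theorem2 (v k : nat) :
  (9 < v)%N -> v = 1 %[mod 4] -> (2 <= k)%N ->
  (exists B : {set {set 'I_v}}, is_STS B /\ has_zero_sum_flow B k) ->
  exists B' : {set {set 'I_(2 * v + 7)}}, is_STS B' /\ has_zero_sum_flow B' k.
Proof.
move=> v9 v1 k1 /has_STS_flow_iff[t [w H]]; apply/has_STS_flow_iff.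
pose m := ((v + 7) %/ 4)%N.
have mE : (v + 7 = 4 * m)%N by rewrite /m; lia.
(* This bound gives ['Z_m] exactly [m] elements and makes 2 nonzero in it. *)
have m2 : (2 < m)%N by lia.
have cM : #|'Z_m| = m by rewrite card_ord Zp_cast //; lia.
have two : 2 != 0 :> 'Z_m.
  by apply/eqP => /(congr1 (@nat_of_ord _)); rewrite val_Zp_nat ?modn_small //=; lia.
have [|t' [w' H']] := steiner_flow_adjoin two k1 _ H; first by rewrite card_ord cM.
apply: steiner_flow_transport H'.
(* The total is [v + 4m], where [4m = v + 7]. *)
by rewrite card_sum !card_prod !card_bool cM !card_ord; lia.
Qed.
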